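(* $V_5=\displaystyle\inf_{a\in[1.6456659,\,2\cos\frac{\pi}{7}]}\frac{q_2(a)}{(\sqrt a-1)^2}=34.8992259$. The infimum is attained at the point $q=(0.2114174,0.5028451,0.6363167,0.5028451,0.2114174,0)\in\mathbb{R}^6$, which corresponds to the cosine polynomial $f(\phi)=\sum_{k=0}^5 a_k\cos k\phi\in C_5$ with $a_0=1$, $a_1=1.7051159$, $a_2=1.0438202$, $a_3=0.4252409$, $a_4=0.0893946$, $a_5=0$.
   Context: For an integer $n\ge 2$, $C_n$ denotes the set of real cosine polynomials $f(\phi)=\sum_{k=0}^{n} a_k\cos(k\phi)$ such that (i) all coefficients are real and nonnegative, (ii) $a_1>a_0>0$, and (iii) $f(\phi)\ge 0$ for all real $\phi$. For $f\in C_n$, $v(f)=\dfrac{f(0)-a_0}{(\sqrt{a_1}-\sqrt{a_0})^2}$ and $V_n=\inf_{f\in C_n}v(f)$. For real $a$, $q_2(a)$ is the minimum of $F(\mathbf x)=(x_0+\dots+x_5)^2-1$ over $\mathbf x=(x_0,\dots,x_5)\in\mathbb{R}^6$ subject to $\sum_{i=0}^5x_i^2=1$, $2(x_0x_1+x_1x_2+\dots+x_4x_5)=a$, and $2x_0x_5\ge 0$. A point $\mathbf x\in\mathbb{R}^{n+1}$ corresponds to the cosine polynomial $|\sum_{k=0}^n x_k e^{ik\phi}|^2=a_0+\sum_{j\ge1}a_j\cos j\phi$ with $a_0=\sum_k x_k^2$ and $a_j=2\sum_{k}x_kx_{k+j}$. Numerical constants are decimal values as given in the paper, to seven decimal places.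 *)

(* Defs.v *)
From HB Require Import structures.
From mathcomp Require Import all_boot all_order all_algebra.
From mathcomp Require Import all_classical all_reals all_analysis.

Set Implicit Arguments.
Unset Strict Implicit.
Unset Printing Implicit Defensive.

Import Order.TTheory GRing.Theory Num.Theory.
Local Open Scope classical_set_scope.
Local Open Scope ring_scope.

(* [coef a k] is only meaningful for k <= n: [inord] sends other indices
   to 0. *)
Definition coef (R : realType) (n : nat) (a : 'rV[R]_n.+1) (k : nat) : R :=
  a 0 (inord k).

(* A cosine polynomial is represented by its row of coefficients, which the
   function phi |-> cospoly a phi determines. *)
Definition cospoly (R : realType) (n : nat) (a : 'rV[R]_n.+1) (phi : R) : R :=
  \sum_(k < n.+1) coef a k * cos (k%:R * phi).

Definition C (R : realType) (n : nat) : set 'rV[R]_n.+1 :=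
  [set a | [/\ forall k : 'I_n.+1, 0 <= coef a k,
               0 < coef a 0 < coef a 1
             & forall phi : R, 0 <= cospoly a phi]].
Arguments C : clear implicits.

Definition v (R : realType) (n : nat) (a : 'rV[R]_n.+1) : R :=
  (cospoly a 0 - coef a 0) / (Num.sqrt (coef a 1) - Num.sqrt (coef a 0)) ^+ 2.

Definition V (R : realType) (n : nat) : R := inf [set v a | a in C R n].

Definition autocorr (R : realType) (n : nat) (x : 'rV[R]_n.+1) :
    'rV[R]_n.+1 :=
  \row_(j < n.+1)
    if j == 0%N :> nat then \sum_(k < n.+1) coef x k ^+ 2
    else 2 * \sum_(k < n.+1 | (k + j <= n)%N) coef x k * coef x (k + j).

Definition F (R : realType) (x : 'rV[R]_6) : R :=
  (\sum_(i < 6) coef x i) ^+ 2 - 1.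

Definition feasible (R : realType) (a : R) : set 'rV[R]_6 :=
  [set x | [/\ \sum_(i < 6) coef x i ^+ 2 = 1,
               2 * \sum_(i < 5) coef x i * coef x i.+1 = a
             & 0 <= 2 * coef x 0 * coef x 5]].

(* The least element of S; 0 if there is none. *)
Definition minimum (R : realType) (S : set R) : R := xget 0 (S `&` lbound S).

Definition q2 (R : realType) (a : R) : R :=
  minimum [set F x | x in feasible a].

(* [decimal i [:: d1; d2; ...]] is the number written i.d1d2... in base ten.
   Literals such as 348992259 are unary in ring_scope, hence intractable. *)
Definition decimal (R : realType) (i : nat) (ds : seq nat) : R :=
  i%:R + foldr (fun d r => (d%:R + r) / 10) 0 ds.

(* A published decimal c stands for an exact x with |x - c| <= e.  Not all the
   published digits are correctly rounded, e.g. the optimal a_1 is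
   1.70511581798 and its published value is 1.7051159; hence the explicit
   tolerance. *)
Definition within_tol (R : realType) (e x c : R) : Prop := `|x - c| <= e.

(* |sum_k x_k e^(i k phi)|^2 is the cosine polynomial with coefficients
   [autocorr x]; the right-hand side is (real part)^2 + (imaginary part)^2. *)
Lemma cospoly_autocorr (R : realType) (n : nat) (x : 'rV[R]_n.+1) (phi : R) :
  cospoly (autocorr x) phi =
  (\sum_(k < n.+1) coef x k * cos (k%:R * phi)) ^+ 2 +
  (\sum_(k < n.+1) coef x k * sin (k%:R * phi)) ^+ 2.
Proof.
pose c (k l : 'I_n.+1) := coef x k * coef x l * cos (l%:R * phi - k%:R * phi).
have cC k l : c k l = c l k by rewrite /c -opprB cosN (mulrC (coef x k)).
have -> : (\sum_(k < n.+1) coef x k * cos (k%:R * phi)) ^+ 2 +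
  (\sum_(k < n.+1) coef x k * sin (k%:R * phi)) ^+ 2 = \sum_k \sum_l c k l.
  rewrite !expr2 !big_distrlr /= -big_split; apply: eq_bigr => k _ /=.
  rewrite -big_split; apply: eq_bigr => l _ /=.
  by rewrite /c cosB mulrDr (mulrACA _ (cos _)) (mulrACA _ (sin _))
    (mulrC (cos (k%:R * _))) (mulrC (sin (k%:R * _))).
have -> : \sum_k \sum_l c k l =
    \sum_k c k k + 2 * \sum_(k < n.+1) \sum_(l < n.+1 | (k < l)%N) c k l.
  have lowE : \sum_(k < n.+1) \sum_(l < n.+1 | (k < l)%N) c k l =
      \sum_(k < n.+1) \sum_(l < n.+1 | (l < k)%N) c k l.
    rewrite (exchange_big_dep xpredT) //=.
    by apply: eq_bigr => k _; apply: eq_bigr => l _.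
  rewrite mulr_natl mulr2n {2}lowE -!big_split /=.
  apply: eq_bigr => k _; rewrite (bigD1 k) //=; congr (_ + _).
  rewrite (bigID (fun l : 'I_n.+1 => (k < l)%N)) /=.
  by congr (_ + _); apply: eq_bigl => l; rewrite -val_eqE /=; case: ltngtP.
rewrite /cospoly big_ord_recl /=; congr (_ + _).
  rewrite /coef mxE inordK //= mul0r cos0 mulr1.
  by apply: eq_bigr => k _; rewrite /c subrr cos0 mulr1 expr2.
rewrite mulr_sumr.
under [RHS]eq_bigr do rewrite mulr_sumr.
have -> : \sum_(i < n.+1) \sum_(l < n.+1 | (i < l)%N) 2 * c i l =
  \sum_(k < n.+1) \sum_(j < n | (k + j.+1 <= n)%N)
     2 * c k (inord (k + j.+1)).
  apply: eq_bigr => k _.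
  rewrite (reindex_omap (fun j : 'I_n => inord (k + j.+1) : 'I_n.+1)
     (fun l : 'I_n.+1 => insub (l - k).-1)) /=.
    apply: eq_bigl => j; apply/idP/idP.
      case: (leqP (k + j.+1) n) => // h.
      by rewrite /inord /insubd insubN ?ltnS -?ltnNge //= ltn0.
    move=> h; rewrite inordK ?ltnS // addnS ltnS leq_addr /=.
    rewrite -addnS addKn /= insubT //= => h'; apply/eqP; congr Some.
    exact/val_inj.
  move=> l kl; have h : ((l - k).-1 < n)%N.
    rewrite prednK ?subn_gt0 // (leq_trans (leq_subr _ _)) //.
    by rewrite -ltnS ltn_ord.
  by rewrite insubT /= prednK ?subn_gt0 // subnKC ?(ltnW kl) // inord_val.
rewrite (exchange_big_dep xpredT) //=; apply: eq_bigr => j _.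
rewrite /coef mxE inordK ?ltnS //= -mulr_sumr -mulrA; congr (_ * _).
rewrite mulr_suml; apply: eq_bigr => k h.
rewrite /c /coef !inordK ?ltnS // inord_val -mulrBl -natrB ?leq_addr //.
by rewrite addKn.
Qed.

(* Main.v *)
(* Linear programming duality.  For t in [1, 2 cos (2 pi / 7)] let
   p = t^2 + t - 1, q = t^2 + 2 t, r = (t + 1)^2.  The polynomial
   |p + q z + r z^2 + q z^3 + p z^4|^2, where z = e^(i phi), vanishes for two
   values of cos phi, and some nonnegative combination of the evaluations at
   these two points has moments 1 in the orders 2, 3 and 4.  Every nonnegative
   cosine polynomial f of degree 5 with a_5 >= 0 thus satisfies
     f(0) - a_0 >= b (a_1 - t a_0) - a_0,
     b = (5 t^2 + 8 t - 1) / (t (3 - t^2)).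
   Let a_0 = 1 and s = sqrt a_1.  If t is chosen such that t + 1 / b = s, the
   bound is b (s^2 - s) = rho(t) (s - 1)^2 for a rational function rho.  At the
   minimum t0 of rho, the vector (p, q, r, q, p, 0) gives equality in the bound
   and satisfies sqrt a_1 = t0 + 1 / b, hence both infima are equal to rho(t0). *)

Require Import Defs.
From mathcomp Require Import all_boot all_order all_algebra.
From mathcomp Require Import all_classical all_reals all_analysis.
From mathcomp Require Import ring lra.

Import Order.TTheory GRing.Theory Num.Theory.
Import numFieldNormedType.Exports.
Local Open Scope classical_set_scope.
Local Open Scope ring_scope.

(** * The dual certificate *)

(** The expansion in Chebyshev polynomials of c = cos phi, so that a cosine polynomial can be
    evaluated at algebraic values of cos phi. *)
Definition cheb {R : realType} (a : 'rV[R]_6) (c : R) : R :=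
  coef a 0 + coef a 1 * c + coef a 2 * (2 * c ^+ 2 - 1)
  + coef a 3 * (4 * c ^+ 3 - 3 * c) + coef a 4 * (8 * c ^+ 4 - 8 * c ^+ 2 + 1)
  + coef a 5 * (16 * c ^+ 5 - 20 * c ^+ 3 + 5 * c).

Lemma cos_natSS {R : realType} (k : nat) (x : R) :
  cos (k.+2%:R * x) = 2 * cos x * cos (k.+1%:R * x) - cos (k%:R * x).
Proof.
have -> : k.+2%:R * x = k.+1%:R * x + x by rewrite -[k.+2]addn1 natrD; ring.
have -> : k%:R * x = k.+1%:R * x - x by rewrite -[k.+1]addn1 natrD; ring.
by rewrite cosD cosB; ring.
Qed.

Lemma cospoly_cheb {R : realType} (a : 'rV[R]_6) (x : R) :
  cospoly a x = cheb a (cos x).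
Proof.
rewrite /cospoly /cheb !big_ord_recl big_ord0 /= /bump /=.
rewrite !cos_natSS !mul0r !mul1r cos0; ring.
Qed.

Lemma cheb_ge0 {R : realType} (a : 'rV[R]_6) (c : R) :
  (forall x : R, 0 <= cospoly a x) -> -1 <= c <= 1 -> 0 <= cheb a c.
Proof.
by move=> a0 c1; rewrite -[c]acosK ?in_itv//= -cospoly_cheb.
Qed.

(* The mean of f(phi) (1 - cos phi) over the multiples of pi/3 is nonnegative. *)
Lemma coef1_le {R : realType} (a : 'rV[R]_6) :
  (forall x : R, 0 <= cospoly a x) -> 0 <= coef a 5 -> coef a 1 <= 2 * coef a 0.
Proof.
move=> a0 a5.
have h1 : 0 <= cheb a (1 / 2) by apply: cheb_ge0 => //; lra.
have h2 : 0 <= cheb a (- (1 / 2)) by apply: cheb_ge0 => //; lra.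
have h3 : 0 <= cheb a (- 1) by apply: cheb_ge0 => //; lra.
rewrite /cheb in h1 h2 h3.
have : 0 <= 6 * coef a 0 - 3 * coef a 1 - 3 * coef a 5 by lra.
lra.
Qed.

(** The number b of the linear programming bound. *)
Definition slope {R : realType} (t : R) : R :=
  (5 * t ^+ 2 + 8 * t - 1) / (t * (3 - t ^+ 2)).

(** Reducing the powers of c modulo its quadratic equation makes the value affine in c. *)
Lemma cheb_red {R : realType} (a : 'rV[R]_6) (c u w : R) : c ^+ 2 = u * c + w ->
  let c3 := u ^+ 2 + w in
  let c4 := u * c3 + u * w in
  cheb a c = coef a 0 + coef a 1 * c + coef a 2 * (2 * (u * c + w) - 1)
  + coef a 3 * (4 * (c3 * c + u * w) - 3 * c)
  + coef a 4 * (8 * (c4 * c + c3 * w) - 8 * (u * c + w) + 1)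
  + coef a 5 * (16 * ((u * c4 + c3 * w) * c + c4 * w)
                - 20 * (c3 * c + u * w) + 5 * c).
Proof.
move=> c2 c3' c4'.
have c3 : c ^+ 3 = c3' * c + u * w.
  by rewrite exprS c2 mulrDr mulrCA -expr2 c2 /c3'; ring.
have c4 : c ^+ 4 = c4' * c + c3' * w.
  by rewrite exprS c3 mulrDr mulrCA -expr2 c2 /c4'; ring.
have c5 : c ^+ 5 = (u * c4' + c3' * w) * c + c4' * w.
  by rewrite exprS c4 mulrDr mulrCA -expr2 c2; ring.
by rewrite /cheb c5 c4 c3 c2.
Qed.

(* For t < 1 the point c2 below leaves [-1, 1], and the multiplier g of the last
   coefficient is nonnegative only for t <= 2 cos (2 pi / 7), about 1.24698. *)
Lemma tangent {R : realType} (t : R) (a : 'rV[R]_6) :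
  1 <= t <= 1246 / 1000 -> (forall x : R, 0 <= cospoly a x) ->
  0 <= coef a 5 ->
  slope t * (coef a 1 - t * coef a 0) - coef a 0 <= cospoly a 0 - coef a 0.
Proof.
move=> /andP[t1 t2] a0 a5.
have t10 : 0 <= t - 1 by rewrite subr_ge0.
pose p : R := t ^+ 2 + t - 1; pose q := t ^+ 2 + 2 * t.
pose e : R := 3 - t ^+ 2.
pose S : R := 5 * t ^+ 2 + 8 * t - 1.
have p0 : 0 < p by rewrite /p; nra.
have e0 : 0 < e by rewrite /e; nra.
have S0 : 0 < S by rewrite /S; nra.
pose D := q ^+ 2 - 4 * p * e.
have D0 : 0 < D.
  have -> : D = 1 + (t - 1) *
      (8 + 42 * (t - 1) + 28 * (t - 1) ^+ 2 + 5 * (t - 1) ^+ 3).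
    by rewrite /D /p /q /e; ring.
  move: (t - 1) t10 => z z0.
  by rewrite ltr_wpDr// !(mulr_ge0, addr_ge0, exprn_ge0).
pose d := Num.sqrt D.
have d2 : d ^+ 2 = D by rewrite sqr_sqrtr// ltW.
have d0 : 0 < d by rewrite sqrtr_gt0.
(* The roots of 4 p c^2 + 2 q c + e, which for c = cos phi is the quartic in z divided by z^2; here
   e = r - 2 p. *)
pose c1 := (d - q) / (4 * p); pose c2 := (- d - q) / (4 * p).
pose u := - q / (2 * p); pose w := - e / (4 * p).
have c1E : c1 ^+ 2 = u * c1 + w.
  apply/eqP; rewrite -subr_eq0; apply/eqP.
  transitivity ((d ^+ 2 - D) / (16 * p ^+ 2)); last by rewrite d2 subrr mul0r.
  by rewrite /D /c1 /u /w; field; rewrite gt_eqF.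
have c2E : c2 ^+ 2 = u * c2 + w.
  apply/eqP; rewrite -subr_eq0; apply/eqP.
  transitivity ((d ^+ 2 - D) / (16 * p ^+ 2)); last by rewrite d2 subrr mul0r.
  by rewrite /D /c2 /u /w; field; rewrite gt_eqF.
have dq : d <= 4 * p - q.
  have h : 0 <= 4 * p - q by rewrite /p /q; nra.
  rewrite -(@ler_pXn2r _ 2)// ?nnegrE ?(ltW d0)// d2 /D.
  rewrite -subr_ge0.
  have -> : (4 * p - q) ^+ 2 - (q ^+ 2 - 4 * p * e) = 4 * p * (t ^+ 2 - 1).
    by rewrite /p /q /e; ring.
  by rewrite !mulr_ge0 ?(ltW p0)//; nra.
have q0 : 0 < q by rewrite /q; nra.
have dltq : d < q.
  rewrite -(@ltr_pXn2r _ 2)// ?nnegrE ?(ltW d0) ?(ltW q0)// d2 /D.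
  have : 0 < 4 * p * e by rewrite !mulr_gt0.
  by lra.
have P1 : 0 <= cheb a c1.
  apply: cheb_ge0 => //; rewrite /c1 ler_pdivlMr ?ler_pdivrMr;
    move: p0 q0 d0 dq dltq; clear; lra.
have P2 : 0 <= cheb a c2.
  apply: cheb_ge0 => //; rewrite /c2 ler_pdivlMr ?ler_pdivrMr;
    move: p0 q0 d0 dq dltq; clear; lra.
(* [m1] and [m0] are the first moments, up to the factor [t * e], of the
   measure supported by [acos c1] and [acos c2]; its moments of orders 2, 3
   and 4 are equal to [t * e], and that of order 5 is [t * e - S * g]. *)
pose m1 := t * e - S; pose m0 := t * e + S * t.
pose g := (t + 1) / p - t.
have g0 : 0 <= g by rewrite subr_ge0 ler_pdivlMr// /p; nra.
(* As m0 > 0, this says that the mean m1 / m0 lies strictly between c2 and c1, so both weights are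
   positive. *)
have Qm : (4 * p * m1 + q * m0) ^+ 2 < (d * m0) ^+ 2.
  rewrite [ltRHS]exprMn d2 -subr_gt0.
  have -> : D * m0 ^+ 2 - (4 * p * m1 + q * m0) ^+ 2 =
     16 * p * (12 + (t - 1) * (126 + (t - 1) * (527 + (t - 1) * (1125
      + (t - 1) * (1320 + (t - 1) * (873 + (t - 1) * (324
      + (t - 1) * (63 + (t - 1) * 5)))))))).
    by rewrite /D /m1 /m0 /p /q /e /S; ring.
  apply: mulr_gt0; first by rewrite pmulr_rgt0 ?ltr0n.
  move: (t - 1) t10 => z z0; apply: ltr_wpDr; last by rewrite ltr0n.
  by repeat first [exact: z0 | exact: ler0n | apply: addr_ge0 | apply: mulr_ge0].
have m00 : 0 < m0 by rewrite /m0 addr_gt0// mulr_gt0//;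
  move: t1; clear; lra.
have : `|4 * p * m1 + q * m0| < d * m0.
  rewrite -(@ltr_pXn2r _ 2)// ?nnegrE ?normr_ge0 ?mulr_ge0 ?(ltW d0) ?(ltW m00)//.
  by rewrite real_normK ?num_real.
rewrite ltr_norml => /andP[lo hi].
have w1 : 0 <= m1 - c2 * m0.
  rewrite /c2 subr_ge0 mulrAC ler_pdivrMr; move: lo hi p0; clear; lra.
have w2 : 0 <= c1 * m0 - m1.
  rewrite /c1 subr_ge0 mulrAC ler_pdivlMr; move: lo hi p0; clear; lra.
have := addr_ge0 (mulr_ge0 w1 P1) (mulr_ge0 w2 P2).
rewrite (cheb_red _ _ _ _ c1E) (cheb_red _ _ _ _ c2E).
set rhs := (X in 0 <= X).
(* For an affine P(c) = A c + B, one has (m1 - c2 m0) P(c1) + (c1 m0 - m1) P(c2) = (c1 - c2) (A m1 +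
   B m0). *)
have -> : rhs = (c1 - c2) * (m0 * coef a 0 + m1 * coef a 1
   + t * e * (coef a 2 + coef a 3 + coef a 4) + (t * e - S * g) * coef a 5).
  by rewrite /rhs /m0 /m1 /u /w /g /S /e /q /p; field; rewrite -/p gt_eqF.
rewrite pmulr_rge0; last first.
  by rewrite /c1 /c2 -mulrBl divr_gt0; move: p0 d0; clear; lra.
move=> L; rewrite cospoly_cheb cos0 /cheb /slope -/S -/e.
rewrite -subr_ge0.
have te0 : 0 < t * e by rewrite mulr_gt0//; move: t1; clear; lra.
rewrite -(pmulr_rge0 _ te0).
(* Adding this nonnegative term raises the moment of order 5 to t e, like those of orders 2, 3 and
   4. *)
have Sg : 0 <= S * g * coef a 5 by rewrite !mulr_ge0// ltW.
apply: (le_trans (addr_ge0 L Sg)); rewrite le_eqVlt; apply/orP; left; apply/eqP.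
rewrite /m0 /m1; field; rewrite !gt_eqF//; move: t1; clear; lra.
Qed.

(** * The rational function rho and its minimum *)

(** The quotient [rhonum t / rhoden t] is rho(t) = b s / (s - 1) for s = t + 1 / b. *)
Definition rhonum {R : realType} (t : R) : R :=
  2 * (5 * t ^+ 2 + 8 * t - 1) * (2 * t ^+ 2 + 4 * t + 1).

Definition rhoden {R : realType} (t : R) : R :=
  (3 - t ^+ 2) * (4 * t ^+ 3 + 3 * t ^+ 2 - 6 * t + 1).

(* Squared norm of the vector of numerators in [extremal]. *)
Definition sqnorm {R : realType} (t : R) : R :=
  5 * t ^+ 4 + 16 * t ^+ 3 + 12 * t ^+ 2 + 3.

(* A quarter of [rhonum^`() * rhoden - rhonum * rhoden^`()]. *)
Definition critpoly {R : realType} (t : R) : R :=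
  (2 * t ^+ 2 + 4 * t + 1) ^+ 2 * sqnorm t
  - (2 * t ^+ 2 + 7 * t + 6) * (5 * t ^+ 2 + 8 * t - 1) ^+ 2.

(** The bracket 1.183445619569 <= t <= 1.183445619570 of the critical point, in groups of three
    digits because literals are unary. *)
Definition tlo {R : realType} : R :=
  1 + (183 + (445 + (619 + 569 / 1000) / 1000) / 1000) / 1000.
Definition thi {R : realType} : R :=
  1 + (183 + (445 + (619 + 570 / 1000) / 1000) / 1000) / 1000.

Lemma critical_point {R : realType} :
  exists2 t : R, tlo <= t <= thi & critpoly t = 0.
Proof.
pose P : {poly R} := (2 *: 'X^2 + 4 *: 'X + 1%:P) ^+ 2
    * (5 *: 'X^4 + 16 *: 'X^3 + 12 *: 'X^2 + 3%:P)
  - (2 *: 'X^2 + 7 *: 'X + 6%:P) * (5 *: 'X^2 + 8 *: 'X - 1%:P) ^+ 2.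
have PE x : P.[x] = critpoly x.
  by rewrite /P !(hornerD, hornerN, horner_exp, hornerM, hornerZ, hornerXn,
    hornerX, hornerC).
have [||t] := @poly_ivt R P tlo thi.
- by rewrite /tlo /thi; lra.
- by rewrite !PE /critpoly /sqnorm /tlo /thi; apply/andP; split; lra.
by move=> t01; rewrite /root PE => /eqP Pt; exists t.
Qed.

Lemma rhoden_gt0 {R : realType} (t : R) : 1 <= t <= 1246 / 1000 -> 0 < rhoden t.
Proof.
move=> /andP[t1 t2]; rewrite /rhoden mulr_gt0//; first by nra.
have -> : 4 * t ^+ 3 + 3 * t ^+ 2 - 6 * t + 1 =
  2 + (t - 1) * (12 + 15 * (t - 1) + 4 * (t - 1) ^+ 2) by ring.
have : 0 <= t - 1 by rewrite subr_ge0.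
move: (t - 1) => z z0.
by rewrite ltr_wpDr// !(mulr_ge0, addr_ge0, exprn_ge0).
Qed.

(* Coefficients, from the second order on, of the Taylor expansion at [x = t] of
   [rhonum x * rhoden t - rhonum t * rhoden x]. *)
Definition taylor2 {R : realType} (t : R) : R :=
  226 - 568 * t - 3996 * t ^+ 2 - 3464 * t ^+ 3 + 2170 * t ^+ 4
  + 4248 * t ^+ 5 + 2016 * t ^+ 6 + 320 * t ^+ 7.
Definition taylor3 {R : realType} (t : R) : R :=
  252 - 1224 * t - 2108 * t ^+ 2 + 1800 * t ^+ 3 + 4528 * t ^+ 4
  + 2592 * t ^+ 5 + 480 * t ^+ 6.
Definition taylor4 {R : realType} (t : R) : R :=
  54 - 376 * t + 530 * t ^+ 2 + 1976 * t ^+ 3 + 1440 * t ^+ 4 + 320 * t ^+ 5.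
Definition taylor5 {R : realType} (t : R) : R :=
  - 8 + 32 * t + 280 * t ^+ 2 + 288 * t ^+ 3 + 80 * t ^+ 4.

(** Each expression has nonnegative coefficients as a polynomial in t - 11 / 10. The fraction 1 / 5
    bounds t - x in [rho_min]. *)
Lemma taylor_ge0 {R : realType} (t : R) : 11 / 10 <= t ->
  [/\ 0 <= taylor2 t - taylor3 t / 5, 0 <= taylor3 t,
      0 <= taylor4 t - taylor5 t / 5 & 0 <= taylor5 t].
Proof.
move=> t1; have [z z0 ->] : exists2 z : R, 0 <= z & t = 11 / 10 + z.
  by exists (t - 11 / 10); lra.
have := (exprn_ge0 2 z0, exprn_ge0 3 z0, exprn_ge0 4 z0, exprn_ge0 5 z0,
  exprn_ge0 6 z0, exprn_ge0 7 z0).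
move=> [[[[[z2 z3] z4] z5] z6] z7] {t t1}.
rewrite /taylor2 /taylor3 /taylor4 /taylor5; split; lra.
Qed.

(** At a critical point the expansion of the cross-multiplied difference starts with (x - t)^2. Its
    cofactor is nonnegative on the whole range of x, so the minimum is global there. *)
Lemma rho_min {R : realType} (t x : R) : 118 / 100 <= t <= 119 / 100 ->
  critpoly t = 0 -> 1 <= x <= 1246 / 1000 ->
  rhonum t * rhoden x <= rhonum x * rhoden t.
Proof.
move=> /andP[tl th] Kt /andP[x1 x2].
rewrite -subr_ge0.
have -> : rhonum x * rhoden t - rhonum t * rhoden x =
    4 * critpoly t * (x - t) + (x - t) ^+ 2 *
     (taylor2 t + taylor3 t * (x - t)
      + (x - t) ^+ 2 * (taylor4 t + taylor5 t * (x - t))).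
  rewrite /rhonum /rhoden /critpoly /sqnorm /taylor2 /taylor3 /taylor4 /taylor5.
  by ring.
rewrite Kt mulr0 mul0r add0r mulr_ge0// ?sqr_ge0//.
have [|e23 e3 e45 e5] := @taylor_ge0 _ t; first by lra.
have xt : 0 <= x - t + 1 / 5 by lra.
have h3 := mulr_ge0 e3 xt; have h5 := mulr_ge0 e5 xt.
apply: addr_ge0; first by lra.
by rewrite mulr_ge0// ?sqr_ge0//; lra.
Qed.

(** Bounding each power of t separately turns the digit checks into linear arithmetic. *)
Lemma exp_bounds {R : realType} (t : R) (k : nat) : tlo <= t <= thi ->
  tlo ^+ k <= t ^+ k <= thi ^+ k.
Proof.
move=> /andP[tl th]; apply/andP.
by split; apply: lerXn2r; rewrite ?nnegrE//;
  move: tl th; rewrite /tlo /thi; clear; lra.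
Qed.

Lemma vopt_bounds {R : realType} (t : R) : tlo <= t <= thi ->
  within_tol (10 ^- 7 / 2) (rhonum t / rhoden t)
    (decimal R 34 [:: 8; 9; 9; 2; 2; 5; 9]%N).
Proof.
move=> tb; have d0 : 0 < rhoden t.
  apply: rhoden_gt0; case/andP: tb => + +; rewrite /tlo /thi; clear => ? ?.
  by apply/andP; split; lra.
rewrite /within_tol ler_distl ler_pdivlMr// ler_pdivrMr// {d0}.
have := (exp_bounds _ 2 tb, exp_bounds _ 3 tb, exp_bounds _ 4 tb,
  exp_bounds _ 5 tb).
case/andP: tb; rewrite /decimal /= /rhonum /rhoden /tlo /thi.
move=> t1 t1' [[[/andP[t2 t2'] /andP[t3 t3']] /andP[t4 t4']] /andP[t5 t5']].
by apply/andP; split; move: t1 t1' t2 t2' t3 t3' t4 t4' t5 t5'; clear; lra.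
Qed.

(* The equation says that t + 1 / slope t = s, in which case the tangent at t is
   proportional to s ^+ 2 - s. *)
Lemma ratio_param {R : realType} (s : R) : 7 / 6 <= s <= 1353 / 1000 ->
  exists2 t : R, 1 <= t <= 1246 / 1000 &
    2 * t * (2 * t ^+ 2 + 4 * t + 1) = s * (5 * t ^+ 2 + 8 * t - 1).
Proof.
move=> /andP[s1 s2].
pose P : {poly R} := 2 *: 'X * (2 *: 'X^2 + 4 *: 'X + 1%:P)
  - s *: (5 *: 'X^2 + 8 *: 'X - 1%:P).
have PE x : P.[x] =
    2 * x * (2 * x ^+ 2 + 4 * x + 1) - s * (5 * x ^+ 2 + 8 * x - 1).
  by rewrite /P !(hornerD, hornerN, hornerM, hornerZ, hornerXn, hornerX, hornerC).
(* The bounds on s come from t + 1 / b at the two ends: 7 / 6 at t = 1, and slightly more than 1353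
   / 1000 at t = 1246 / 1000. *)
have [||t] := @poly_ivt R P 1 (1246 / 1000); first by lra.
  by rewrite !PE; apply/andP; split; lra.
by move=> t12; rewrite /root PE subr_eq0 => /eqP Pt; exists t.
Qed.

(** By homogeneity only s = sqrt (a_1 / a_0) matters. For s <= 7 / 6, the bound f(0) - a_0 >= a_1
    suffices; up to 1353 / 1000, the tangent with t + 1 / b = s is used; from there to sqrt 2, the
    single tangent at 1246 / 1000. The disjunction serves both problems: its first case holds on
    C_5, its second in the quadratic program. *)
Lemma cospoly_lower_bound {R : realType} (t : R) (a : 'rV[R]_6) :
  118 / 100 <= t <= 119 / 100 -> critpoly t = 0 ->
  rhonum t / rhoden t <= 349 / 10 ->
  (forall x : R, 0 <= cospoly a x) -> 0 <= coef a 5 ->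
  0 < coef a 0 < coef a 1 ->
  coef a 1 <= cospoly a 0 - coef a 0 \/
    7 / 6 * Num.sqrt (coef a 0) < Num.sqrt (coef a 1) ->
  rhonum t / rhoden t * (Num.sqrt (coef a 1) - Num.sqrt (coef a 0)) ^+ 2
    <= cospoly a 0 - coef a 0.
Proof.
move=> t12 Kt v_le fge0 a5 /andP[a0 a01] small_or.
set v := rhonum t / rhoden t in v_le *.
have := coef1_le _ fge0 a5.
have tan u u12 := @tangent _ u a u12 fge0 a5.
pose x := Num.sqrt (coef a 0); pose y := Num.sqrt (coef a 1).
have x0 : 0 < x by rewrite sqrtr_gt0.
have y0 : 0 < y by rewrite sqrtr_gt0 (lt_trans a0).
have xE : coef a 0 = x ^+ 2 by rewrite sqr_sqrtr ?ltW.
have yE : coef a 1 = y ^+ 2 by rewrite sqr_sqrtr// ltW// (lt_trans a0).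
pose s := y / x.
have ysx : y = s * x by rewrite /s divfK// gt_eqF.
have s1 : 1 < s by rewrite /s ltr_pdivlMr// mul1r ltr_sqrt// (lt_trans a0).
move: s ysx s1 => s ysx s1.
rewrite -/x -/y in small_or *.
move: small_or tan; rewrite yE xE ysx => {a0 a01 yE xE ysx y0 fge0 a5 y}.
set g := cospoly a 0 - _.
move: g => g small_or tan.
rewrite exprMn ler_pM2r ?exprn_gt0// => s2.
have -> : v * (s * x - x) ^+ 2 = v * (s - 1) ^+ 2 * x ^+ 2 by ring.
have suff_s c : v * (s - 1) ^+ 2 <= c -> c * x ^+ 2 <= g ->
    v * (s - 1) ^+ 2 * x ^+ 2 <= g.
  by move=> vc; apply: le_trans; rewrite ler_pM2r// exprn_gt0.
have vs : v * (s - 1) ^+ 2 <= 349 / 10 * (s - 1) ^+ 2.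
  by rewrite ler_wpM2r// sqr_ge0.
have [s_small|s_large] := leP s (7 / 6).
  have {small_or}small : s ^+ 2 * x ^+ 2 <= g.
    case: small_or; first by rewrite exprMn.
    by rewrite ltr_pM2r// ltNge s_small.
  apply: (suff_s (s ^+ 2)) => //; apply: (le_trans vs).
  by nra.
have [s_mid|s_top] := leP s (1353 / 1000).
  have [|u /andP[u1 u2] us] := @ratio_param _ s; first by rewrite ltW.
  have den0 : 0 < rhoden u by apply: rhoden_gt0; rewrite u1.
  have S0 : 0 < 5 * u ^+ 2 + 8 * u - 1 by move: u1; clear; nra.
  have e0 : 0 < 3 - u ^+ 2 by move: u1 u2; clear; nra.
  apply: (suff_s (slope u * (s ^+ 2 - u) - 1)); last first.
    apply: le_trans (tan u _); last by rewrite u1.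
    by rewrite le_eqVlt; apply/orP; left; apply/eqP; ring.
  have vu : v <= rhonum u / rhoden u.
    rewrite /v ler_pdivrMr ?rhoden_gt0//; last by move: t12; clear; lra.
    by rewrite mulrAC ler_pdivlMr// rho_min// u1.
  apply: (le_trans (ler_wpM2r (sqr_ge0 _) vu)).
  rewrite le_eqVlt; apply/orP; left; apply/eqP.
  have sE : s = 2 * u * (2 * u ^+ 2 + 4 * u + 1) / (5 * u ^+ 2 + 8 * u - 1).
    by rewrite us mulfK// gt_eqF.
  rewrite /rhoden pmulr_rgt0// in den0.
  rewrite sE /slope /rhonum /rhoden; field.
  by rewrite !gt_eqF//; move: u1; clear; lra.
have s2' : s <= 1415 / 1000 by move: s1 s2; clear; nra.
apply: (suff_s (slope (1246 / 1000) * (s ^+ 2 - 1246 / 1000) - 1)); last first.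
  apply: le_trans (tan (1246 / 1000) _); last by clear; lra.
  by rewrite le_eqVlt; apply/orP; left; apply/eqP; ring.
apply: (le_trans vs).
have slope_ge : 9276 / 1000 <= slope (1246 / 1000) :> R.
  by rewrite /slope ler_pdivlMr; clear; lra.
have s_bd : 0 <= s ^+ 2 - 1246 / 1000 by move: s_top; clear; nra.
by move: (ler_wpM2r s_bd slope_ge) s_top s2'; clear; nra.
Qed.

(** * The extremal vector *)

Lemma coef_autocorr {R : realType} (x : 'rV[R]_6) :
  let f := autocorr x in
  [/\ coef f 0 = \sum_(i < 6) coef x i ^+ 2,
      coef f 1 = 2 * \sum_(i < 5) coef x i * coef x i.+1,
      coef f 2 = 2 * (coef x 0 * coef x 2 + coef x 1 * coef x 3
                      + coef x 2 * coef x 4 + coef x 3 * coef x 5)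
    & [/\ coef f 3 = 2 * (coef x 0 * coef x 3 + coef x 1 * coef x 4
                          + coef x 2 * coef x 5),
          coef f 4 = 2 * (coef x 0 * coef x 4 + coef x 1 * coef x 5)
        & coef f 5 = 2 * coef x 0 * coef x 5]].
Proof.
split; last split; rewrite {1}/coef mxE inordK//= big_mkcond !big_ord_recl
  !big_ord0 /= /bump /= ?(add0n, add1n, addn1); ring.
Qed.

Lemma cospoly_autocorr0 {R : realType} (x : 'rV[R]_6) :
  cospoly (autocorr x) 0 = (\sum_(i < 6) coef x i) ^+ 2.
Proof.
rewrite cospoly_autocorr.
under eq_bigr do rewrite mulr0 cos0 mulr1.
under [X in _ + X ^+ 2]eq_bigr do rewrite mulr0 sin0 mulr0.
by rewrite big1_eq expr0n addr0.
Qed.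

Lemma cospoly_autocorr_ge0 {R : realType} (x : 'rV[R]_6) (phi : R) :
  0 <= cospoly (autocorr x) phi.
Proof. by rewrite cospoly_autocorr addr_ge0// sqr_ge0. Qed.

Definition extremal {R : realType} (t : R) : 'rV[R]_6 :=
  \row_(j < 6) ([:: t ^+ 2 + t - 1; t ^+ 2 + 2 * t; (t + 1) ^+ 2;
                    t ^+ 2 + 2 * t; t ^+ 2 + t - 1; 0]`_j / Num.sqrt (sqnorm t)).

Lemma sqnorm_gt0 {R : realType} (t : R) : 0 <= t -> 0 < sqnorm t.
Proof.
by move=> t0; rewrite /sqnorm ltr_wpDl// !(addr_ge0, mulr_ge0, exprn_ge0).
Qed.

Lemma coef_extremal {R : realType} (t : R) :
  let w := Num.sqrt (sqnorm t) in let q := extremal t in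
  [/\ coef q 0 = (t ^+ 2 + t - 1) / w, coef q 1 = (t ^+ 2 + 2 * t) / w,
      coef q 2 = (t + 1) ^+ 2 / w, coef q 3 = (t ^+ 2 + 2 * t) / w
    & coef q 4 = (t ^+ 2 + t - 1) / w /\ coef q 5 = 0].
Proof. by split; last split; rewrite /coef mxE inordK//= mul0r. Qed.

Lemma coef_autocorr_extremal {R : realType} (t : R) : 0 <= t ->
  let f := autocorr (extremal t) in let N := sqnorm t in
  [/\ coef f 0 = 1,
      coef f 1 = 4 * (2 * t ^+ 4 + 7 * t ^+ 3 + 6 * t ^+ 2) / N,
      coef f 2 = 2 * (3 * t ^+ 4 + 10 * t ^+ 3 + 8 * t ^+ 2 - 2 * t - 2) / N
    & [/\ coef f 3 = 4 * (t ^+ 4 + 3 * t ^+ 3 + t ^+ 2 - 2 * t) / N,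
          coef f 4 = 2 * (t ^+ 4 + 2 * t ^+ 3 - t ^+ 2 - 2 * t + 1) / N
        & coef f 5 = 0]].
Proof.
move=> t0; have N0 := sqnorm_gt0 t t0.
have w2 : Num.sqrt (sqnorm t) ^+ 2 = sqnorm t by rewrite sqr_sqrtr// ltW.
have w0 : Num.sqrt (sqnorm t) != 0 by rewrite gt_eqF// sqrtr_gt0.
rewrite /=.
have [-> -> -> [-> -> ->]] := coef_autocorr (extremal t).
rewrite !big_ord_recl !big_ord0 /= /bump /= ?(add0n, add1n).
have [-> -> -> -> [-> ->]] := coef_extremal t.
move: w2 w0 N0; set w := Num.sqrt _ => w2 w0 N0.
split; last split; rewrite -?w2; try by field.
transitivity (sqnorm t / w ^+ 2); first by rewrite /sqnorm; field.
by rewrite w2 divff// gt_eqF.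
Qed.

Lemma extremal_sum {R : realType} (t : R) :
  \sum_(i < 6) coef (extremal t) i =
  (5 * t ^+ 2 + 8 * t - 1) / Num.sqrt (sqnorm t).
Proof.
rewrite !big_ord_recl !big_ord0 /= /bump /= ?(add0n, add1n).
have [-> -> -> -> [-> ->]] := coef_extremal t.
by rewrite !addr0 -!mulrDl; congr (_ / _); ring.
Qed.

Lemma extremal_value {R : realType} (t : R) : 1 <= t <= 1246 / 1000 ->
  critpoly t = 0 ->
  F (extremal t) = rhonum t / rhoden t *
    (Num.sqrt (coef (autocorr (extremal t)) 1) - 1) ^+ 2.
Proof.
move=> t12 Kt; have den0 := rhoden_gt0 t t12; case/andP: t12 => t1 t2.
have t0 : 0 <= t by lra.
have N0 := sqnorm_gt0 t t0.
have S0 : 0 < 5 * t ^+ 2 + 8 * t - 1 by nra.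
have e0 : 0 < 3 - t ^+ 2 by nra.
rewrite /F extremal_sum expr_div_n sqr_sqrtr ?ltW//.
have W0 : 0 < 2 * t ^+ 2 + 4 * t + 1 by nra.
(* Solving [critpoly t = 0] for the squared norm makes a_1 the perfect square (t + 1 / b)^2. *)
have NE : sqnorm t = (2 * t ^+ 2 + 7 * t + 6) * (5 * t ^+ 2 + 8 * t - 1) ^+ 2
    / (2 * t ^+ 2 + 4 * t + 1) ^+ 2.
  apply: (canRL (mulfK _)); first by rewrite expf_neq0// gt_eqF.
  by rewrite mulrC; exact: subr0_eq Kt.
have h0 : 0 < 2 * t ^+ 2 + 7 * t + 6 by nra.
have -> : Num.sqrt (coef (autocorr (extremal t)) 1) =
    2 * t * (2 * t ^+ 2 + 4 * t + 1) / (5 * t ^+ 2 + 8 * t - 1).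
  have [_ -> _ _] := coef_autocorr_extremal t t0.
  rewrite NE -[RHS]ger0_norm; last first.
    by rewrite divr_ge0 ?mulr_ge0// ltW.
  rewrite -sqrtr_sqr; congr Num.sqrt; field.
  by rewrite !gt_eqF//; lra.
rewrite /rhoden pmulr_rgt0// in den0.
apply/eqP; rewrite -subr_eq0 NE; apply/eqP.
(* The critical equation enters again: with the norm eliminated, the difference of the two sides is
   a multiple of [critpoly t]. *)
transitivity (- critpoly t / ((3 - t ^+ 2) * (5 * t ^+ 2 + 8 * t - 1)
    * (2 * t ^+ 2 + 7 * t + 6))); last by rewrite Kt oppr0 mul0r.
rewrite /critpoly /sqnorm /rhonum /rhoden; field.
by rewrite !gt_eqF.
Qed.

(** * Decimal values of the extremal vector and its cosine polynomial *)

Lemma div_within {R : realType} (x w wl wh c e : R) : 0 < w -> wl <= w <= wh ->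
  0 <= c - e -> (c - e) * wh <= x <= (c + e) * wl -> 0 <= c + e -> 
  within_tol e (x / w) c.
Proof.
move=> w0 /andP[w1 w2] ce /andP[x1 x2] ce'.
rewrite /within_tol ler_distl ler_pdivlMr// ler_pdivrMr//.
rewrite (le_trans _ x1) ?ler_wpM2l//=.
by rewrite (le_trans x2)// ler_wpM2l.
Qed.

(** Nine decimals suffice below and avoid the long fractions [tlo ^+ k] and [thi ^+ k]. *)
Lemma exp_digits {R : realType} (t : R) : tlo <= t <= thi ->
  [/\ 1 + (183 + (445 + 619 / 1000) / 1000) / 1000
        <= t <= 1 + (183 + (445 + 620 / 1000) / 1000) / 1000,
      1 + (400 + (543 + 534 / 1000) / 1000) / 1000
        <= t ^+ 2 <= 1 + (400 + (543 + 535 / 1000) / 1000) / 1000,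
      1 + (657 + (467 + 110 / 1000) / 1000) / 1000
        <= t ^+ 3 <= 1 + (657 + (467 + 111 / 1000) / 1000) / 1000 &
      1 + (961 + (522 + 191 / 1000) / 1000) / 1000
        <= t ^+ 4 <= 1 + (961 + (522 + 192 / 1000) / 1000) / 1000].
Proof.
move=> tb; have := (exp_bounds _ 2 tb, exp_bounds _ 3 tb, exp_bounds _ 4 tb).
case/andP: tb; rewrite /tlo /thi.
move=> t1 t1' [[/andP[t2 t2'] /andP[t3 t3']] /andP[t4 t4']].
split; apply/andP; split.
- by move: t1; clear; lra.
- by move: t1'; clear; lra.
- by move: t2; clear; lra.
- by move: t2'; clear; lra.
- by move: t3; clear; lra.
- by move: t3'; clear; lra.
- by move: t4; clear; lra.
- by move: t4'; clear; lra.
Qed.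

Lemma sqrtr_within {R : realType} (x a b : R) :
  0 <= a -> 0 <= b -> a ^+ 2 <= x -> x <= b ^+ 2 -> a <= Num.sqrt x <= b.
Proof.
move=> a0 b0 ax xb; apply/andP; split.
  by rewrite -[leLHS](ger0_norm a0) -sqrtr_sqr ler_wsqrtr.
by rewrite -[leRHS](ger0_norm b0) -sqrtr_sqr ler_wsqrtr.
Qed.

Lemma norm_digits {R : realType} (t : R) : tlo <= t <= thi ->
  7 + (492 + (236 + 457 / 1000) / 1000) / 1000 <= Num.sqrt (sqnorm t)
    <= 7 + (492 + (236 + 460 / 1000) / 1000) / 1000.
Proof.
move=> tb; have := (exp_bounds _ 2 tb, exp_bounds _ 3 tb, exp_bounds _ 4 tb).
case/andP: tb; rewrite /tlo /thi.
move=> t1 t1' [[/andP[t2 t2'] /andP[t3 t3']] /andP[t4 t4']].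
apply: sqrtr_within; rewrite /sqnorm.
- by clear; lra.
- by clear; lra.
- by move: t3 t4 t2; clear; lra.
- by move: t3' t4' t2'; clear; lra.
Qed.

Lemma extremal_digits {R : realType} (t : R) : tlo <= t <= thi ->
  let ulp : R := 10 ^- 7 in let q := extremal t in
  [/\ within_tol ulp (coef q 0) (decimal R 0 [:: 2; 1; 1; 4; 1; 7; 4]%N),
      within_tol ulp (coef q 1) (decimal R 0 [:: 5; 0; 2; 8; 4; 5; 1]%N),
      within_tol ulp (coef q 2) (decimal R 0 [:: 6; 3; 6; 3; 1; 6; 7]%N),
      within_tol ulp (coef q 3) (decimal R 0 [:: 5; 0; 2; 8; 4; 5; 1]%N)
    & within_tol ulp (coef q 4) (decimal R 0 [:: 2; 1; 1; 4; 1; 7; 4]%N)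
      /\ coef q 5 = 0].
Proof.
move=> tb ulp q.
have [-> -> -> -> [-> ->]] := coef_extremal t.
have wb := norm_digits _ tb.
have w0 : 0 < Num.sqrt (sqnorm t).
  by case/andP: wb => + _; apply: lt_le_trans; clear; lra.
have [/andP[t1 t1'] /andP[t2 t2'] _ _] := exp_digits _ tb.
move: (Num.sqrt _) w0 wb => w w0 wb {tb}.
rewrite /ulp /decimal /= {ulp q}.
split; last split; last reflexivity; apply: div_within w0 wb _ _ _;
  try (clear; lra).
all: by apply/andP; split; move: t1 t1' t2 t2'; clear; lra.
Qed.

Lemma extremal_coef_digits {R : realType} (t : R) : tlo <= t <= thi ->
  let ulp : R := 10 ^- 7 in let f := autocorr (extremal t) in
  [/\ within_tol ulp (coef f 1) (decimal R 1 [:: 7; 0; 5; 1; 1; 5; 9]%N),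
      within_tol ulp (coef f 2) (decimal R 1 [:: 0; 4; 3; 8; 2; 0; 2]%N),
      within_tol ulp (coef f 3) (decimal R 0 [:: 4; 2; 5; 2; 4; 0; 9]%N)
    & within_tol ulp (coef f 4) (decimal R 0 [:: 0; 8; 9; 3; 9; 4; 6]%N)
      /\ coef f 5 = 0].
Proof.
move=> tb ulp f.
have t0 : 0 <= t.
  by case/andP: tb => + _; apply: le_trans; rewrite /tlo; clear; lra.
have [_ -> -> [-> -> ->]] := coef_autocorr_extremal _ t0.
have N0 := sqnorm_gt0 _ t0.
have [/andP[t1 t1'] /andP[t2 t2'] /andP[t3 t3'] /andP[t4 t4']] := exp_digits _ tb.
rewrite /within_tol /ulp /decimal /= {ulp f}.
split; last split; last reflexivity;
  rewrite ler_distl (ler_pdivlMr _ _ N0) (ler_pdivrMr _ _ N0).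
all: rewrite /sqnorm; apply/andP; split.
all: by move: t1 t1' t2 t2' t3 t3' t4 t4'; clear; lra.
Qed.

(** * Attainment in the quadratic program *)

Lemma coef_continuous {R : realType} (k : nat) :
  continuous (fun x : 'rV[R]_6 => coef x k).
Proof. exact: coord_continuous. Qed.

Lemma sum_continuous {R : realType} (T : topologicalType) (n : nat)
    (f : 'I_n -> T -> R) :
  (forall i, continuous (f i)) -> continuous (fun x => \sum_(i < n) f i x).
Proof.
by move=> fc x; apply: cvg_big => [|i _]; [exact: add_continuous | exact: fc].
Qed.

Lemma mul_continuous {R : realType} (T : topologicalType) (f g : T -> R) :
  continuous f -> continuous g -> continuous (fun x => f x * g x).
Proof. by move=> fc gc x; apply: cvgM; [exact: fc | exact: gc]. Qed.

Lemma sqr_continuous {R : realType} (T : topologicalType) (f : T -> R) :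
  continuous f -> continuous (fun x => f x ^+ 2).
Proof.
by move=> fc; under eq_fun do rewrite expr2; exact: mul_continuous.
Qed.

Lemma subr_cst_continuous {R : realType} (T : topologicalType) (f : T -> R)
    (c : R) :
  continuous f -> continuous (fun x => f x - c).
Proof. by move=> fc x; apply: cvgB; [exact: fc | exact: cvg_cst]. Qed.

Lemma closed_feasible {R : realType} (a : R) : closed (feasible a).
Proof.
have cc k := @coef_continuous R k.
pose f1 (x : 'rV[R]_6) := \sum_(i < 6) coef x i ^+ 2.
pose f2 (x : 'rV[R]_6) := 2 * \sum_(i < 5) coef x i * coef x i.+1.
pose f3 (x : 'rV[R]_6) := 2 * coef x 0 * coef x 5.
have c1 : continuous f1.
  by apply: sum_continuous => i; apply: sqr_continuous; exact: cc.
have c2 : continuous f2.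
  apply: mul_continuous; first exact: cst_continuous.
  by apply: sum_continuous => i; apply: mul_continuous; exact: cc.
have c3 : continuous f3.
  by do 2 ?apply: mul_continuous; [exact: cst_continuous | exact: cc | exact: cc].
have -> : feasible a =
    f1 @^-1` [set y | y = 1] `&` f2 @^-1` [set y | y = a] `&`
    f3 @^-1` [set y | 0 <= y].
  by apply/seteqP; split => x [] // [].
apply: closedI; [apply: closedI|]; apply: preimage_closed.
- by move=> x _; exact: c1.
- exact: closed_eq.
- by move=> x _; exact: c2.
- exact: closed_eq.
- by move=> x _; exact: c3.
- exact: closed_ge.
Qed.

Lemma compact_feasible {R : realType} (a : R) : compact (feasible a).
Proof.
apply: bounded_closed_compact; last exact: closed_feasible.
exists 1; split=> // M M1 x [x1 _ _] /=.
rewrite [leLHS]/Num.norm /= mx_normrE; apply: bigmax_le; first by lra.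
move=> [k i] _ /=; apply: le_trans (ltW M1).
have -> : x k i = coef x i by rewrite /coef inord_val (ord1 k).
rewrite -(@ler_pXn2r _ 2)// ?nnegrE// expr1n real_normK ?num_real// -x1.
by rewrite (bigD1 i)//= lerDl sumr_ge0// => j _; exact: sqr_ge0.
Qed.

(** A least element is unique, which determines the choice made by [xget]. *)
Lemma q2_eq {R : realType} (a : R) (x : 'rV[R]_6) : feasible a x ->
  (forall z, feasible a z -> F x <= F z) -> q2 a = F x.
Proof.
move=> xa xmin; apply: xget_unique.
  by split; [exists x | move=> _ [z za <-]; exact: xmin].
move=> _ [[z za <-] zmin]; apply/le_anti; rewrite xmin// andbT.
by apply: zmin; exists x.
Qed.

Lemma q2_attained {R : realType} (a : R) : feasible a !=set0 ->
  exists2 x, feasible a x & q2 a = F x.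
Proof.
move=> a0.
have Sc : continuous (fun x : 'rV[R]_6 => \sum_(i < 6) coef x i).
  by apply: sum_continuous => i; exact: coef_continuous.
have Fc : {within feasible a, continuous (@F R)}.
  apply: continuous_subspaceT.
  exact: (subr_cst_continuous _ _ 1 (sqr_continuous _ _ Sc)).
have [x /set_mem xa xmin] := EVT_min_rV a0 (compact_feasible a) Fc.
by exists x => //; apply: q2_eq => // z za; exact/xmin/mem_set.
Qed.

(** For th = pi / 7, cos (4 th) + cos (3 th) = 0 factors as c + 1 times the cubic in 2 c, where c =
    cos th. *)
Lemma cos_pi7 {R : realType} : let y : R := 2 * cos (pi / 7) in
  171 / 100 <= y /\ y ^+ 3 - y ^+ 2 - 2 * y + 1 = 0.
Proof.
move=> y; set th : R := pi / 7.
have pi0 := pi_gt0 R.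
have c0 : 0 < cos th.
  by apply: cos_gt0_pihalf; apply/andP; split; rewrite /th; lra.
have c2 : 0 < cos (2%:R * th).
  by apply: cos_gt0_pihalf; apply/andP; split; rewrite /th; lra.
have c4 : cos (4%:R * th) = - cos (3%:R * th).
  have -> : 4%:R * th = - (3%:R * th) + pi by rewrite /th; field.
  by rewrite cosDpi cosN.
move: c2 c4; rewrite !cos_natSS mul1r mul0r cos0.
rewrite /y -/th; move: (cos th) c0 => c c0 c2 c4 {y th pi0}.
have cubic : (2 * c) ^+ 3 - (2 * c) ^+ 2 - 2 * (2 * c) + 1 = 0.
  have : (c + 1) * ((2 * c) ^+ 3 - (2 * c) ^+ 2 - 2 * (2 * c) + 1) = 0.
    move/eqP: c4; rewrite -subr_eq0 => /eqP <-; ring.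
  by move/eqP; rewrite mulf_eq0 => /orP[/eqP ?|/eqP //]; lra.
split=> //; rewrite leNgt; apply/negP => c_lt.
(* The product is the cubic plus 0.343889, hence positive at a root. Since cos (2 th) > 0 gives (2
   c)^2 > 2, the quadratic factor is positive. *)
have : (2 * c - 171 / 100) *
    ((2 * c) ^+ 2 + 71 / 100 * (2 * c) - 7859 / 10000) < 0.
  rewrite nmulr_rlt0; last by lra.
  by nra.
move: cubic; lra.
Qed.

(* (1, y, y^2 - 1, y^2 - 1, y, 1) is an eigenvector, with eigenvalue
   y = 2 cos (pi / 7), of the adjacency matrix of the path on six vertices.  The
   entries at even and at odd positions have the same squared norm M; scaling
   them by l and m gives the squared norm (l^2 + m^2) M and a_1 = 2 l m y M. *)
Lemma feasible_nonempty {R : realType} (a : R) :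
  0 <= a <= 2 * cos (pi / 7) -> feasible a !=set0.
Proof.
have [] := @cos_pi7 R; move: (2 * cos _) => y y1 cubic /andP[a0 ay].
pose z := y ^+ 2 - 1; pose M := 1 + y ^+ 2 + z ^+ 2.
have M0 : 0 < M by rewrite /M ltr_wpDr ?sqr_ge0// ltr_wpDr ?sqr_ge0.
have y0 : 0 < y by lra.
(* A = l + m and B = l - m are found from the required values of l^2 + m^2 and l m; a <= y makes the
   second radicand nonnegative. *)
pose A := Num.sqrt ((1 + a / y) / M); pose B := Num.sqrt ((1 - a / y) / M).
have A2 : A ^+ 2 = (1 + a / y) / M.
  by rewrite sqr_sqrtr// divr_ge0 ?ltW// ltr_wpDr// divr_ge0// ltW.
have B2 : B ^+ 2 = (1 - a / y) / M.
  by rewrite sqr_sqrtr// divr_ge0 ?(ltW M0)// subr_ge0 ler_pdivrMr// mul1r.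
pose l := (A + B) / 2; pose m := (A - B) / 2.
have lm : l * m = a / (2 * y * M).
  transitivity ((A ^+ 2 - B ^+ 2) / 4); first by rewrite /l /m; field.
  by rewrite A2 B2; field; rewrite !gt_eqF.
have l2m2 : l ^+ 2 + m ^+ 2 = 1 / M.
  transitivity ((A ^+ 2 + B ^+ 2) / 2); first by rewrite /l /m; field.
  by rewrite A2 B2; field; rewrite !gt_eqF.
exists (\row_(j < 6) [:: l; m * y; l * z; m * z; l * y; m]`_j).
rewrite /feasible /= !big_ord_recl !big_ord0 /coef !mxE /= !inordK//= /bump /=.
split.
- transitivity ((l ^+ 2 + m ^+ 2) * M); first by rewrite /M; ring.
  by rewrite l2m2 divfK// gt_eqF.
- transitivity (2 * (l * m) *
    (y * M + (y ^+ 3 - y ^+ 2 - 2 * y + 1) * (1 - y ^+ 2))).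
    by rewrite /M /z; ring.
  by rewrite cubic mul0r addr0 lm; field; rewrite !gt_eqF.
- by rewrite -mulrA lm mulr_ge0// divr_ge0// ltW// !mulr_gt0.
Qed.

(** * Both infima equal the minimum of rho *)

Lemma inf_least {R : realType} (S : set R) (m : R) :
  S m -> lbound S m -> inf S = m.
Proof.
move=> Sm lb; apply/le_anti/andP; split.
  by apply: ge_inf => //; exists m.
by apply: lb_le_inf => //; exists m.
Qed.

Theorem theorem5p2 (R : realType) :
  let D : set R := `[decimal R 1 [:: 6; 4; 5; 6; 6; 5; 9]%N,
                     2 * cos (pi / 7)]%classic in
  let r (a : R) : R := q2 a / (Num.sqrt a - 1) ^+ 2 in
  let ulp : R := 10 ^- 7 in
  [/\ V R 5 = inf [set r a | a in D],
      within_tol (ulp / 2) (V R 5) (decimal R 34 [:: 8; 9; 9; 2; 2; 5; 9]%N)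
    & exists q : 'rV[R]_6,
      let f := autocorr q in
      [/\ [/\ within_tol ulp (coef q 0) (decimal R 0 [:: 2; 1; 1; 4; 1; 7; 4]%N),
              within_tol ulp (coef q 1) (decimal R 0 [:: 5; 0; 2; 8; 4; 5; 1]%N),
              within_tol ulp (coef q 2) (decimal R 0 [:: 6; 3; 6; 3; 1; 6; 7]%N),
              within_tol ulp (coef q 3) (decimal R 0 [:: 5; 0; 2; 8; 4; 5; 1]%N)
            & within_tol ulp (coef q 4) (decimal R 0 [:: 2; 1; 1; 4; 1; 7; 4]%N)
              /\ coef q 5 = 0],
          [/\ D (coef f 1),
              feasible (coef f 1) q,
              F q = q2 (coef f 1)
            & r (coef f 1) = inf [set r a | a in D]],
          C R 5 f,
          v f = V R 5
        & [/\ coef f 0 = 1,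
              within_tol ulp (coef f 1) (decimal R 1 [:: 7; 0; 5; 1; 1; 5; 9]%N),
              within_tol ulp (coef f 2) (decimal R 1 [:: 0; 4; 3; 8; 2; 0; 2]%N),
              within_tol ulp (coef f 3) (decimal R 0 [:: 4; 2; 5; 2; 4; 0; 9]%N)
            & within_tol ulp (coef f 4) (decimal R 0 [:: 0; 8; 9; 3; 9; 4; 6]%N)
              /\ coef f 5 = 0]]].
Proof.
move=> D r ulp.
have [t tb Kt] := @critical_point R.
have t12 : 118 / 100 <= t <= 119 / 100.
  by move: tb; rewrite /tlo /thi; clear => /andP[? ?]; apply/andP; split; lra.
have t12' : 1 <= t <= 1246 / 1000.
  by move: t12; clear => /andP[? ?]; apply/andP; split; lra.
have t0 : 0 <= t by move: t12; clear => /andP[? ?]; lra.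
set w := rhonum t / rhoden t.
have wdig : within_tol (ulp / 2) w (decimal R 34 [:: 8; 9; 9; 2; 2; 5; 9]%N).
  exact: vopt_bounds.
have w_le : w <= 349 / 10.
  move: wdig; rewrite /within_tol ler_distl /ulp /decimal /=; clear.
  by move=> /andP[_ ?]; lra.
pose q := extremal t; pose f := autocorr q.
have [f0 f1E f2E [f3E f4E f5]] := coef_autocorr_extremal t t0.
have fdig := extremal_coef_digits _ tb.
have f1b : 170 / 100 <= coef f 1 <= 171 / 100.
  move: fdig; rewrite /= -/q -/f => -[+ _ _ _].
  rewrite /within_tol ler_distl /decimal /=; clear=> /andP[? ?].
  by apply/andP; split; lra.
have Fq : F q = w * (Num.sqrt (coef f 1) - 1) ^+ 2 by exact: extremal_value.
have [y171 _] := @cos_pi7 R.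
have Df1 : D (coef f 1).
  rewrite /D /= in_itv /=; move: f1b y171; rewrite /decimal /=; clear.
  by move=> /andP[? ?] ?; apply/andP; split; lra.
(* A feasible x yields a nonnegative cosine polynomial with a_0 = 1, a_1 = a and a_5 = 2 x_0 x_5 >=
   0. Its other coefficients may be negative, so the case s <= 7 / 6 is excluded through the size of
   a. *)
have feas_bound a x : D a -> feasible a x -> w * (Num.sqrt a - 1) ^+ 2 <= F x.
  move=> Da [x1 xa x05].
  have [g0 g1 _ [_ _ g5]] := coef_autocorr x.
  rewrite x1 in g0; rewrite xa in g1.
  have a_ge : 164 / 100 <= a.
    move: Da; rewrite /D /= in_itv /= /decimal /=; clear => /andP[? _]; lra.
  have sq_a : 7 / 6 < Num.sqrt a.
    have a76 : 0 <= 7 / 6 :> R by clear; lra.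
    by rewrite -(ger0_norm a76) -sqrtr_sqr ltr_sqrt; move: a_ge; clear; lra.
  have := @cospoly_lower_bound R t (autocorr x) t12 Kt w_le.
  rewrite g0 g1 g5 sqrtr1 cospoly_autocorr0 mulr1 -/w => -> //.
  - by exact: cospoly_autocorr_ge0.
  - by apply/andP; split; [exact: ltr01 | move: a_ge; clear; lra].
  - by right.
have qfeas : feasible (coef f 1) q.
  have [g0 g1 _ [_ _ g5]] := coef_autocorr q.
  by split; rewrite -?g0 -?g1 -?g5// /f f5.
have q2f : q2 (coef f 1) = F q.
  by apply: q2_eq => // z zf; rewrite Fq; exact: feas_bound.
have sqrt_gt1 a : D a -> 0 < (Num.sqrt a - 1) ^+ 2.
  move=> Da; rewrite exprn_gt0// subr_gt0 -[ltLHS]sqrtr1 ltr_sqrt.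
    by move: Da; rewrite /D /= in_itv /= /decimal /=; clear => /andP[? _]; lra.
  by move: Da; rewrite /D /= in_itv /= /decimal /=; clear => /andP[? _]; lra.
have rf : r (coef f 1) = w.
  by rewrite /r q2f Fq mulfK// gt_eqF// sqrt_gt1.
have inf_r : inf [set r a | a in D] = w.
  apply: inf_least; first by exists (coef f 1).
  move=> _ [a Da <-]; rewrite /r ler_pdivlMr ?sqrt_gt1//.
  (* As a <= 2 cos (pi / 7), the feasible set is nonempty and [q2 a] is a true minimum, not the
     default 0. *)
  have [|x xa ->] := @q2_attained R a; last exact: feas_bound.
  apply: feasible_nonempty; move: Da; rewrite /D /= in_itv /= /decimal /=; clear.
  by move=> /andP[? ->]; rewrite andbT; lra.
have vf : v f = w.
  rewrite /v /f cospoly_autocorr0 f0 sqrtr1 -/(F q) Fq mulfK// gt_eqF//.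
  exact: sqrt_gt1.
have Cf : C R 5 f.
  split; last exact: cospoly_autocorr_ge0.
    have ge0 x c : 0 <= c - ulp -> within_tol ulp x c -> 0 <= x.
      by move=> c0; rewrite /within_tol ler_distl => /andP[+ _]; exact: le_trans.
    have [_ f2d f3d [f4d _]] := fdig.
    case=> [[|[|[|[|[|[|//]]]]]] klt] /=; rewrite ?f0 ?f5//.
    - by move: f1b; clear => /andP[? _]; lra.
    - by apply: ge0 f2d; rewrite /ulp /decimal /=; clear; lra.
    - by apply: ge0 f3d; rewrite /ulp /decimal /=; clear; lra.
    - by apply: ge0 f4d; rewrite /ulp /decimal /=; clear; lra.
  by rewrite f0 ltr01 /=; move: f1b; clear=> /andP[? _]; lra.
have VE : V R 5 = w.
  apply: inf_least; first by exists f.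
  move=> _ [a [a_ge0 a01 age0] <-].
  have g0 (k : 'I_6) : 0 <= coef a k by exact: a_ge0.
  have := @cospoly_lower_bound R t a t12 Kt w_le age0 (g0 (@Ordinal 6 5 isT)) a01.
  rewrite /v ler_pdivlMr; last first.
    case/andP: a01 => a0 a1.
    by rewrite exprn_gt0// subr_gt0 ltr_sqrt// (lt_trans a0).
  (* Nonnegativity of a_2, ..., a_5 gives f(0) - a_0 >= a_1. *)
  apply; left; rewrite cospoly_cheb cos0 /cheb.
  have := (g0 (@Ordinal 6 2 isT), g0 (@Ordinal 6 3 isT), g0 (@Ordinal 6 4 isT),
    g0 (@Ordinal 6 5 isT)).
  by move=> /= [[[? ?] ?] ?]; lra.
rewrite inf_r VE; split=> //; exists q; split.
- exact: extremal_digits.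
- by split => //; rewrite inf_r.
- exact: Cf.
- exact: vf.
- by case: fdig => ? ? ? ?; split.
Qed.
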